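(* Let $h$ be upper semicontinuous on $\Omega\cup\Gamma_N$ and let $u\in C(\Omega\cup\Gamma_N)$ be a viscosity subsolution of the system $$-\Delta_\infty u-\beta|Du|= h \text{ in }\Omega,\qquad D_\nu u=0\text{ on }\Gamma_N.$$ Then for every $\varepsilon>0$, $$a^+_\varepsilon(\beta)\,S^-_\varepsilon u^\varepsilon(x)-a^-_\varepsilon(\beta)\,S^+_\varepsilon u^\varepsilon(x)\le h^{2\varepsilon}(x)\qquad\text{for every }x\in\Omega_{2\varepsilon}.$$
   Context: Standing setting: $\Omega\subseteq\mathbb{R}^n$ is a bounded, open, connected set with $C^1$ boundary; $\nu$ is the outward unit normal to $\partial\Omega$. For some open set $A\subseteq\mathbb{R}^n$, $\Gamma_N:=\partial\Omega\cap A$ and $\Gamma_D:=\partial\Omega\setminus A$, and $\Gamma_D\neq\emptyset$. If $\Gamma_N\neq\emptyset$, $\Omega$ is assumed convex. $\beta\in\mathbb{R}$ is fixed. For $\varphi\in C^2$: $\Delta_\infty^+\varphi(x):=|D\varphi(x)|^{-2}\langle D^2\varphi(x)D\varphi(x),D\varphi(x)\rangle$ if $D\varphi(x)\ne0$, and $\Delta_\infty^+\varphi(x):=\max\{\langle D^2\varphi(x)v,v\rangle:|v|=1\}$ if $D\varphi(x)=0$. Viscosity subsolution: for $h$ upper semicontinuous on $\Omega\cup\Gamma_N$, an upper semicontinuous $u$ is a viscosity subsolution of the system if for every $\varphi\in C^2(\bar\Omega)$ and every $x_0\in\Omega\cup\Gamma_N$ at which $u-\varphi$ has a local maximum (relative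 to $\bar\Omega$), either $-\Delta^+_\infty\varphi(x_0)-\beta|D\varphi(x_0)|\le h(x_0)$, or $x_0\in\Gamma_N$ and $D\varphi(x_0)\cdot\nu(x_0)\le 0$. Notation: $\Omega_\varepsilon:=\{x\in\bar\Omega:\operatorname{dist}(x,\Gamma_D)>\varepsilon\}$. For a function $w$ and $x\in\Omega_\varepsilon$, $w^\varepsilon(x):=\max_{\bar B(x,\varepsilon)\cap\bar\Omega}w$ and $w_\varepsilon(x):=\min_{\bar B(x,\varepsilon)\cap\bar\Omega}w$; $S^+_\varepsilon w(x):=\frac1\varepsilon(w^\varepsilon(x)-w(x))$, $S^-_\varepsilon w(x):=\frac1\varepsilon(w(x)-w_\varepsilon(x))$. Coefficients: for $\beta\neq0$, $a^+_\varepsilon(\beta):=\frac{\beta}{e^{\varepsilon\beta}-1}$, $a^-_\varepsilon(\beta):=\frac{\beta}{1-e^{-\varepsilon\beta}}$; $a^\pm_\varepsilon(0):=1/\varepsilon$. *)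

(* Defs.v *)
From HB Require Import structures.
From mathcomp Require Import all_boot all_order all_algebra.
From mathcomp Require Import all_classical all_reals all_analysis.
Set Implicit Arguments. Unset Strict Implicit. Unset Printing Implicit Defensive.
Import Order.TTheory GRing.Theory Num.Theory.
Import numFieldNormedType.Exports.
Local Open Scope classical_set_scope.
Local Open Scope ring_scope.

Section Defs.
Variables (R : realType) (n : nat).
Notation V := 'rV[R]_n.

Definition evec (i : 'I_n) : V := delta_mx 0 i.

(* Euclidean inner product and norm (NOT the library's sup-norm) *)
Definition edot (p q : V) : R := \sum_i p 0 i * q 0 i.
Definition enorm (p : V) : R := Num.sqrt (edot p p).
Definition edist (x y : V) : R := enorm (x - y).

Definition pder (f : V -> R) (i : 'I_n) (x : V) : R := derive f x (evec i).
Definition grad (f : V -> R) (x : V) : V := \row_i pder f i x.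
Definition hess (f : V -> R) (x : V) : 'M[R]_n :=
  \matrix_(i, j) pder (pder f i) j x.

Definition C1 (f : V -> R) : Prop :=
  continuous f /\
  forall i, (forall x, derivable f x (evec i)) /\ continuous (pder f i).
Definition C2 (f : V -> R) : Prop := C1 f /\ forall i, C1 (pder f i).

Definition qform (M : 'M[R]_n) (v : V) : R := (v *m M *m v^T) 0 0.

Definition inftylap_plus (phi : V -> R) (x : V) : R :=
  if grad phi x != 0 then
    (enorm (grad phi x)) ^- 2 * qform (hess phi x) (grad phi x)
  else sup [set qform (hess phi x) v | v in [set v : V | enorm v = 1]].

Definition bdry (O : set V) : set V := closure O `\` interior O.

Definition ebounded (O : set V) : Prop :=
  exists M : R, forall x, O x -> enorm x <= M.

Definition convex_set_ (O : set V) : Prop :=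
  forall x y (t : R), O x -> O y -> 0 <= t <= 1 -> O ((1 - t) *: x + t *: y).

(* C^1 boundary with outward unit normal nu: near each boundary point x0,
   O is the sublevel set {rho < 0} of a C^1 function rho whose gradient does
   not vanish on {rho = 0}, and nu x0 = D rho(x0)/|D rho(x0)|. *)
Definition C1_boundary_normal (O : set V) (nu : V -> V) : Prop :=
  forall x0, bdry O x0 ->
    exists (r : R) (rho : V -> R), 0 < r /\ C1 rho /\
      (forall y, edist y x0 < r -> (O y <-> rho y < 0)) /\
      (forall y, edist y x0 < r -> rho y = 0 -> grad rho y != 0) /\
      nu x0 = (enorm (grad rho x0))^-1 *: grad rho x0.

Definition usc_on (E : set V) (f : V -> R) : Prop :=
  forall x, E x -> forall e : R, 0 < e -> exists d : R, 0 < d /\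
    forall y, E y -> edist y x < d -> f y < f x + e.
Definition cont_on (E : set V) (f : V -> R) : Prop :=
  forall x, E x -> forall e : R, 0 < e -> exists d : R, 0 < d /\
    forall y, E y -> edist y x < d -> `|f y - f x| < e.

(* viscosity subsolution of  -Delta_infty u - beta |Du| = h in O,
   D_nu u = 0 on GN; u is defined (only meaningfully) on O `|` GN *)
Definition visc_subsol (O GN : set V) (nu : V -> V) (beta : R)
    (h u : V -> R) : Prop :=
  usc_on (O `|` GN) u /\
  forall (phi : V -> R) (x0 : V), C2 phi -> (O `|` GN) x0 ->
    (exists r : R, 0 < r /\ forall y, closure O y -> edist y x0 < r ->
        u y - phi y <= u x0 - phi x0) ->
    (- inftylap_plus phi x0 - beta * enorm (grad phi x0) <= h x0)
    \/ (GN x0 /\ edot (grad phi x0) (nu x0) <= 0).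

Definition setdist (x : V) (S : set V) : R := inf [set edist x y | y in S].

Definition Omega_eps (O GD : set V) (eps : R) : set V :=
  [set x | closure O x /\ eps < setdist x GD].

Definition supB (O : set V) (eps : R) (w : V -> R) (x : V) : R :=
  sup [set w y | y in [set y | closure O y /\ edist y x <= eps]].
Definition infB (O : set V) (eps : R) (w : V -> R) (x : V) : R :=
  inf [set w y | y in [set y | closure O y /\ edist y x <= eps]].

Definition Splus (O : set V) (eps : R) (w : V -> R) (x : V) : R :=
  (supB O eps w x - w x) / eps.
Definition Sminus (O : set V) (eps : R) (w : V -> R) (x : V) : R :=
  (w x - infB O eps w x) / eps.

End Defs.

Definition a_plus (R : realType) (eps beta : R) : R :=
  if beta == 0 then eps^-1 else beta / (expR (eps * beta) - 1).
Definition a_minus (R : realType) (eps beta : R) : R :=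
  if beta == 0 then eps^-1 else beta / (1 - expR (- (eps * beta))).

(* Main.v *)
(** Let x be in Omega_{2 eps}, m = u(x), and let M1, M2 be the maxima of u over
    the traces on the closure of Omega of the balls B(x, eps), B(x, 2 eps), and
    C the maximum of h over the latter. Since u <= (u^eps)_eps at x and
    (u^eps)^eps = u^{2 eps} at x, it suffices to show
    a^+ (M1 - m) - a^- (M2 - M1) <= eps C, which is an equality for the values
    at 0, eps, 2 eps of a solution g of - g'' - beta g' = C. If it failed, one
    could choose C' > C and a solution g for C' with g(0) > m, g(eps) < M1 and
    g(2 eps) > M2. With a vertex x' in Omega close to x, the maximum of
    u - g(|. - x'|) is then attained inside the ball and away from x', at a
    point where g' > 0; testing there gives C' <= h, while the Neumann
    alternative is excluded because (w - x') . nu(w) > 0 on the boundary of a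
    convex set. When g would first decrease, the solution with g'(0) = 0 is used
    instead, and the maximum may also be attained at x', where g is compared
    with a paraboloid. *)
Require Import Defs.
From HB Require Import structures.
From mathcomp Require Import all_boot all_order all_algebra.
From mathcomp Require Import all_classical all_reals all_analysis.
From mathcomp Require Import ring lra.
Set Implicit Arguments. Unset Strict Implicit. Unset Printing Implicit Defensive.
Import Order.TTheory GRing.Theory Num.Theory.
Import numFieldNormedType.Exports.
Local Open Scope classical_set_scope.
Local Open Scope ring_scope.
(* [all_analysis] shadows [edist]. *)
Import Defs.

(** * Euclidean norm and topology *)

Section Euclid.
Context {R : realType} {n : nat}.
Implicit Types (p q v w x y z : 'rV[R]_n).

Lemma edotC p q : edot p q = edot q p.
Proof. by apply: eq_bigr => i _; rewrite mulrC. Qed.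

Lemma edotDl p q v : edot (p + q) v = edot p v + edot q v.
Proof. by rewrite /edot -big_split /=; apply: eq_bigr => i _; rewrite mxE mulrDl. Qed.

Lemma edotZl (a : R) p v : edot (a *: p) v = a * edot p v.
Proof. by rewrite /edot mulr_sumr; apply: eq_bigr => i _; rewrite mxE mulrA. Qed.

Lemma edot0l v : edot 0 v = 0.
Proof. by rewrite -(scale0r 0) edotZl mul0r. Qed.

Lemma edotNl p v : edot (- p) v = - edot p v.
Proof. by rewrite -scaleN1r edotZl mulN1r. Qed.

Lemma edotBl p q v : edot (p - q) v = edot p v - edot q v.
Proof. by rewrite edotDl edotNl. Qed.

Lemma edotDr p q v : edot v (p + q) = edot v p + edot v q.
Proof. by rewrite edotC edotDl !(edotC _ v). Qed.

Lemma edotZr (a : R) p v : edot v (a *: p) = a * edot v p.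
Proof. by rewrite edotC edotZl edotC. Qed.

Lemma edot_ge0 p : 0 <= edot p p.
Proof. by apply: sumr_ge0 => i _; rewrite -expr2 sqr_ge0. Qed.

Lemma edot_eq0 p : (edot p p == 0) = (p == 0).
Proof.
apply/eqP/eqP => [h|->]; last by rewrite /edot big1 // => i _; rewrite mxE mul0r.
apply/rowP => i; rewrite mxE; apply/eqP; rewrite -sqrf_eq0 expr2; apply/eqP.
by apply: (psumr_eq0P _ h) => // j _; rewrite -expr2 sqr_ge0.
Qed.

Lemma enorm_ge0 p : 0 <= enorm p.
Proof. exact: sqrtr_ge0. Qed.

Lemma sqr_enorm p : enorm p ^+ 2 = edot p p.
Proof. by rewrite sqr_sqrtr ?edot_ge0. Qed.

Lemma enorm_eq0 p : (enorm p == 0) = (p == 0).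
Proof. by rewrite -edot_eq0 -sqr_enorm sqrf_eq0. Qed.

Lemma enorm0 : enorm (0 : 'rV[R]_n) = 0.
Proof. by apply/eqP; rewrite enorm_eq0. Qed.

Lemma enormZ (a : R) p : enorm (a *: p) = `|a| * enorm p.
Proof. by rewrite /enorm edotZl edotZr mulrA -expr2 sqrtrM ?sqr_ge0// sqrtr_sqr. Qed.

Lemma enormN p : enorm (- p) = enorm p.
Proof. by rewrite -scaleN1r enormZ normrN1 mul1r. Qed.

(** Cauchy-Schwarz: the squared length of [enorm q *: p - enorm p *: q] factors as
    [2 * (enorm p * enorm q)] times the difference of the two sides. *)
Lemma edot_le_enorm p q : edot p q <= enorm p * enorm q.
Proof.
have [->|p0] := eqVneq p 0; first by rewrite enorm0 mul0r edot0l.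
have [->|q0] := eqVneq q 0; first by rewrite enorm0 mulr0 edotC edot0l.
have a0 : 0 < enorm p by rewrite lt_def enorm_eq0 p0 enorm_ge0.
have b0 : 0 < enorm q by rewrite lt_def enorm_eq0 q0 enorm_ge0.
have := edot_ge0 (enorm q *: p - enorm p *: q).
rewrite edotBl 2!edotZl !(edotC _ (_ - _)) !edotBl !edotZl -!sqr_enorm (edotC q p).
have -> : enorm q * (enorm q * enorm p ^+ 2 - enorm p * edot p q) -
  enorm p * (enorm q * edot p q - enorm p * enorm q ^+ 2) =
  2 * (enorm p * enorm q) * (enorm p * enorm q - edot p q) by ring.
by rewrite pmulr_rge0 ?subr_ge0 // !mulr_gt0.
Qed.

Lemma enormD p q : enorm (p + q) <= enorm p + enorm q.
Proof.
rewrite -(@ler_pXn2r _ 2) ?nnegrE ?addr_ge0 ?enorm_ge0 //.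
rewrite sqr_enorm edotDl !edotDr -!sqr_enorm (edotC q p) sqrrD.
have := edot_le_enorm p q; lra.
Qed.

Lemma edistC x y : edist x y = edist y x.
Proof. by rewrite /edist -enormN opprB. Qed.

Lemma edistxx x : edist x x = 0.
Proof. by rewrite /edist subrr enorm0. Qed.

Lemma edist_ge0 x y : 0 <= edist x y.
Proof. exact: enorm_ge0. Qed.

Lemma edist_triangle z x y : edist x y <= edist x z + edist z y.
Proof. by rewrite /edist -{1}(subrK z x) -addrA; exact: enormD. Qed.

Lemma edist_eq0 x y : (edist x y == 0) = (x == y).
Proof. by rewrite /edist enorm_eq0 subr_eq0. Qed.

Lemma edist_segment x y (t : R) : 0 <= t ->
  edist ((1 - t) *: x + t *: y) x = t * edist y x.
Proof.
move=> t0; rewrite /edist -(ger0_norm t0) -enormZ ger0_norm //.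
by congr enorm; rewrite scalerBl scale1r scalerBr addrAC addrC [x - _ - x]addrAC subrr sub0r.
Qed.

Lemma coord_le_edist x y i : `|x 0 i - y 0 i| <= edist x y.
Proof.
rewrite -sqrtr_sqr /edist /enorm ler_sqrt ?edot_ge0 // /edot (bigD1 i) //= !mxE -expr2.
by rewrite lerDl; apply: sumr_ge0 => j _; rewrite -expr2 sqr_ge0.
Qed.

Lemma edist_le_coord x y (d : R) : 0 <= d ->
  (forall i, `|x 0 i - y 0 i| <= d) -> edist x y <= n%:R * d.
Proof.
move=> d0 h; rewrite -(@ler_pXn2r _ 2) ?nnegrE ?mulr_ge0 ?edist_ge0 //.
rewrite sqr_enorm exprMn; apply: (@le_trans _ _ (n%:R * d ^+ 2)); last first.
  rewrite ler_wpM2r ?sqr_ge0 // expr2 -natrM ler_nat.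
  by case: n => // m; rewrite leq_pmulr.
rewrite /edot (le_trans (ler_sum _ (G := fun=> d ^+ 2) _)) //.
  move=> i _; rewrite !mxE -expr2 -real_normK ?num_real // lerXn2r //.
by rewrite sumr_const card_ord mulr_natl.
Qed.

(* The topology of ['rV[R]_n] is defined coordinatewise, not by [edist]. *)
Lemma nbhs_edist x (U : set 'rV[R]_n) :
  nbhs x U <-> exists d : R, 0 < d /\ forall y, edist y x < d -> U y.
Proof.
split=> [[P Px PU]|[d [d0 dU]]].
  have Pd i : exists d : R, 0 < d /\ forall t, `|t - x 0 i| < d -> P 0 i t.
    have /nbhs_ballP [d d0 dP] := Px 0 i.
    by exists d; split=> // t td; apply: dP; rewrite -ball_normE /= distrC.
  have [d dP] := choice Pd.
  exists (\big[Num.min/1]_i d i); split.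
    by elim/big_ind : _ => // [a b a0 b0|i _]; [rewrite lt_min a0|exact: (dP i).1].
  move=> y yd; apply: PU => i j; rewrite (ord1 i); apply: (dP j).2.
  by apply: (le_lt_trans (coord_le_edist _ _ _)); apply: (lt_le_trans yd); rewrite bigmin_le_cond.
pose e : R := d / n.+1%:R.
have e0 : 0 < e by rewrite divr_gt0.
exists (fun i j => [set t | `|t - x i j| < e]).
  move=> i j; apply/nbhs_ballP; exists e => // t; by rewrite -ball_normE /= distrC.
move=> y /= h; apply: dU; apply: (@le_lt_trans _ _ (n%:R * e)).
  by apply: edist_le_coord => [|i]; apply: ltW.
by rewrite /e mulrCA gtr_pMr // ltr_pdivrMr // mul1r ltr_nat.
Qed.

Lemma continuous_edist z : continuous (fun x => edist x z).
Proof.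
move=> x U /nbhs_ballP [e e0 eU]; apply/nbhs_edist; exists e; split=> // y yx.
apply: eU; rewrite -ball_normE /= ltr_norml.
have := edist_triangle x y z; have := edist_triangle y x z.
rewrite (edistC x y); lra.
Qed.

Lemma closureP (S : set 'rV[R]_n) x :
  closure S x <-> forall d : R, 0 < d -> exists y, S y /\ edist y x < d.
Proof.
split=> [cx d d0|h U /nbhs_edist [d [d0 dU]]].
  have [|y [Sy yd]] := cx [set y | edist y x < d]; last by exists y.
  by apply/nbhs_edist; exists d.
by have [y [Sy yd]] := h d d0; exists y; split=> //; exact: dU.
Qed.

Lemma closure_convex (S : set 'rV[R]_n) :
  convex_set_ S -> convex_set_ (closure S).
Proof.
move=> cS x y t /closureP cx /closureP cy /[dup] t01 /andP[t0 t1].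
apply/closureP => d d0.
have [x' [Sx' xd]] := cx d d0; have [y' [Sy' yd]] := cy d d0.
exists ((1 - t) *: x' + t *: y'); split; first exact: cS.
have -> : edist ((1 - t) *: x' + t *: y') ((1 - t) *: x + t *: y) =
    enorm ((1 - t) *: (x' - x) + t *: (y' - y)).
  by congr enorm; rewrite !scalerBr opprD addrACA.
apply: (le_lt_trans (enormD _ _)); rewrite !enormZ ger0_norm ?subr_ge0 // ger0_norm //.
rewrite -!/(edist _ _).
(* The strict inequality below is drawn from the [y] term, whose weight must be positive. *)
have [->|tn0] := eqVneq t 0; first by rewrite mul0r addr0 subr0 mul1r.
have t_gt0 : 0 < t by rewrite lt_def tn0.
have : 0 < t * (d - edist y' y) by rewrite mulr_gt0 ?subr_gt0.
have : 0 <= (1 - t) * (d - edist x' x) by rewrite mulr_ge0 ?subr_ge0 // ltW.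
lra.
Qed.

End Euclid.

(** * Compactness and calculus on the line *)

Section Compactness.
Context {R : realType} {n : nat}.
Implicit Types (x y z : 'rV[R]_n) (K : set 'rV[R]_n) (f : 'rV[R]_n -> R).

Definition trace_ball (O : set 'rV[R]_n) (r : R) x : set 'rV[R]_n :=
  [set y | closure O y /\ edist y x <= r].

Lemma compact_trace_ball (O : set 'rV[R]_n) (r : R) x : compact (trace_ball O r x).
Proof.
apply: (@subclosed_compact _ _ [set v : 'rV[R]_n | forall i, `[x 0 i - r, x 0 i + r]%classic (v ord0 i)]).
- move=> y /closureP cy; split.
    by apply: closed_closure => U /nbhs_edist [d [d0 dU]];
       have [z [[cz _] zd]] := cy d d0; exists z; split=> //; exact: dU.
  apply/ler_addgt0Pr => d d0; have [z [[_ zr] zd]] := cy d d0.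
  have := edist_triangle z y x; rewrite (edistC y z); lra.
- by apply: (@rV_compact _ _ (fun i => `[x 0 i - r, x 0 i + r]%classic)) => i; exact: segment_compact.
- move=> y [_ yx] i /=; rewrite in_itv /=.
  have := le_trans (coord_le_edist y x i) yx; rewrite ler_norml; lra.
Qed.

(** Without a maximum, the superlevel sets at points of [K] generate a proper filter. At a cluster
    point [x] some [y] has a larger value, yet upper semicontinuity keeps [f] below [f y] near
    [x]. *)
Lemma usc_max K f : compact K -> K !=set0 -> usc_on K f ->
  exists x, K x /\ forall y, K y -> f y <= f x.
Proof.
move=> cK [k0 Kk0] uf; apply: contrapT => nomax.
have up x : K x -> exists y, K y /\ f x < f y.
  move=> Kx; apply: contrapT => h; apply: nomax; exists x; split=> // y Ky.
  by rewrite leNgt; apply/negP => xy; apply: h; exists y.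
pose F := filter_from K (fun y => [set i | K i /\ f y <= f i]).
have FF : ProperFilter F.
  apply: filter_from_proper => [|y Ky]; last by exists y.
  apply: filter_from_filter => [|i j Ki Kj]; first by exists k0.
  have [ij|/ltW ji] := leP (f i) (f j).
    by exists j => // k [Kk jk]; do !split=> //; exact: (le_trans ij).
  by exists i => // k [Kk jk]; do !split=> //; exact: (le_trans ji).
have [|x [Kx clx]] := cK F FF; first by exists k0 => // y [].
have [y [Ky xy]] := up x Kx.
have e0 : 0 < f y - f x by rewrite subr_gt0.
have [d [d0 df]] := uf x Kx _ e0.
have [||z [[Kz yz] zx]] := clx [set i | K i /\ f y <= f i] [set z | edist z x < d].
- by exists y.
- by apply/nbhs_edist; exists d.
by have := df z Kz zx; lra.
Qed.

Lemma cont_usc K f : cont_on K f -> usc_on K f.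
Proof.
move=> cf x Kx e e0; have [d [d0 df]] := cf x Kx e e0; exists d; split=> // y Ky yd.
by have := df y Ky yd; rewrite ltr_norml; lra.
Qed.

Lemma sub_usc_on K L f : K `<=` L -> usc_on L f -> usc_on K f.
Proof.
move=> KL uf x Kx e e0; have [d [d0 df]] := uf x (KL _ Kx) e e0.
by exists d; split=> // y Ky; apply: df; exact: KL.
Qed.

Lemma usc_subl K f (c : 'rV[R]_n -> R) : usc_on K f -> continuous c ->
  usc_on K (fun x => f x - c x).
Proof.
move=> uf cc x Kx e e0; have e2 : 0 < e / 2 by lra.
have [d [d0 df]] := uf x Kx _ e2.
have : nbhs x [set y | `|c y - c x| < e / 2].
  have : nbhs (c x) [set t | `|t - c x| < e / 2].
    by apply/nbhs_ballP; exists (e / 2) => // t; rewrite -ball_normE /= distrC.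
  by move/(cc x).
move=> /nbhs_edist [d' [d'0 dc]].
exists (Num.min d d'); split=> [|y Ky]; first by rewrite lt_min d0.
rewrite lt_min => /andP[yd yd'].
by have := df y Ky yd; have := dc y yd'; rewrite /= ltr_norml; lra.
Qed.

End Compactness.

Section RealLine.
Context {R : realType}.
Implicit Types (f g : R -> R) (s t : R).

Lemma is_derive_mean f (df : R -> R) s t : (forall x : R, is_derive x 1 f (df x)) -> s <= t ->
  exists c, s <= c <= t /\ f t - f s = df c * (t - s).
Proof.
move=> fd st; have [|c] := @MVT_segment R f df s t st (fun x _ => fd x).
  by apply: derivable_within_continuous => x _; have [] := fd x.
by rewrite in_itv; exists c.
Qed.

Lemma is_derive_continuous f (df x : R) : is_derive x 1 f df -> {for x, continuous f}.
Proof. by case=> /derivable1_diffP /differentiable_continuous. Qed.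

Lemma near_real (P : set R) s : nbhs s P ->
  exists d : R, 0 < d /\ forall t, `|t - s| < d -> P t.
Proof.
move=> /nbhs_ballP [d d0 dP]; exists d; split=> // t td.
by apply: dP; rewrite -ball_normE /= distrC.
Qed.

(** [f2] stays positive near [s], and two mean values carry this sign to [f]. The lemma serves to
    show that a test function touches a radial profile from above. *)
Lemma second_order_local_min f f1 f2 s : (forall x : R, is_derive x 1 f (f1 x)) ->
  (forall x : R, is_derive x 1 f1 (f2 x)) -> {for s, continuous f2} ->
  f s = 0 -> f1 s = 0 -> 0 < f2 s ->
  exists d : R, 0 < d /\ forall t, `|t - s| < d -> 0 <= f t.
Proof.
move=> d1 d2 cf2 fs f1s f2s.
have [d [d0 dP]] : exists d : R, 0 < d /\ forall t, `|t - s| < d -> 0 < f2 t.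
  have /cf2 : nbhs (f2 s) [set y | 0 < y] by apply: open_nbhs_nbhs; split=> //; exact: open_gt.
  exact: near_real.
exists d; split=> // t; rewrite ltr_norml => /andP[td dt].
have [st|/ltW ts] := leP s t.
  have [c [/andP[sc ct]]] := is_derive_mean d1 st; rewrite fs subr0 => ->.
  have [b [/andP[sb bc]]] := is_derive_mean d2 sc; rewrite f1s subr0 => ->.
  have f2b : 0 < f2 b by apply: dP; rewrite ltr_norml; lra.
  by rewrite !mulr_ge0 ?subr_ge0 // ltW.
have [c [/andP[tc cs]] e] := is_derive_mean d1 ts.
have [b [/andP[cb bs]] e'] := is_derive_mean d2 cs.
have f2b : 0 < f2 b by apply: dP; rewrite ltr_norml; lra.
have -> : f t = f2 b * (s - c) * (s - t) by move: e e'; rewrite fs f1s => e e'; rewrite -e'; lra.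
by rewrite !mulr_ge0 ?subr_ge0 // ltW.
Qed.

End RealLine.

(** * The equation y'' + beta y' = const and the coefficients of the scheme *)

Section OneDimensional.
Context {R : realType}.
Variable beta : R.
Implicit Types (s t : R).

(* [theta] and [kappa] solve y'' + beta y' = 0 and y'' + beta y' = 1, with
   y(0) = 0 and y'(0) = 1, respectively y'(0) = 0. *)
Definition expo s : R := expR (- (s * beta)).
Definition theta s : R := if beta == 0 then s else (1 - expo s) / beta.
Definition kappa s : R := if beta == 0 then s ^+ 2 / 2 else (s - theta s) / beta.

Lemma expo_gt0 s : 0 < expo s.
Proof. exact: expR_gt0. Qed.

(** The equation integrated once. It holds for beta = 0 too, so [expo] can be eliminated without a
    case split. *)
Lemma expo_theta s : expo s = 1 - beta * theta s.
Proof.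
rewrite /theta /expo; case: eqVneq => [->|b0]; first by rewrite mulr0 oppr0 expR0 mul0r subr0.
by rewrite mulrCA mulfV // mulr1 subKr.
Qed.

Lemma theta0 : theta 0 = 0.
Proof. by rewrite /theta /expo mul0r oppr0 expR0 subrr mul0r if_same. Qed.

Lemma kappa0 : kappa 0 = 0.
Proof. by rewrite /kappa theta0 subrr expr0n /= !mul0r if_same. Qed.

Lemma is_derive_expo s : is_derive s 1 expo (- beta * expo s).
Proof.
have e : expo = expR \o ( *%R (- beta)) by apply/funext => t; rewrite /expo /= mulNr mulrC.
rewrite [in X in is_derive _ _ X]e mulrC; apply: is_derive1_comp; first by rewrite e; exact: is_derive_expR.
have := @is_deriveZ _ _ _ (@id R) (- beta) s 1 1 (is_derive_id _ _).
by rewrite /GRing.scale /= mulr1.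
Qed.

Lemma is_derive_theta s : is_derive s 1 theta (expo s).
Proof.
rewrite /theta; case: eqVneq => [b0|b0].
  by rewrite /expo b0 mulr0 oppr0 expR0; exact: is_derive_id.
have := is_deriveZ (beta^-1) (is_deriveB (is_derive_cst (1 : R) s (1 : R)) (is_derive_expo s)).
have -> : beta^-1 *: (0 - - beta * expo s) = expo s.
  by rewrite mulNr opprK add0r /GRing.scale /= mulKf.
by congr is_derive; apply/funext => t /=; rewrite mulrC.
Qed.

Lemma is_derive_kappa s : is_derive s 1 kappa (theta s).
Proof.
rewrite /kappa; case: eqVneq => [b0|b0].
  have := is_deriveZ (2^-1) (is_deriveX 2 (is_derive_id s (1 : R))).
  have -> : 2^-1 *: ((2%:R * s ^+ 2.-1) *: 1) = theta s.
    by rewrite /theta b0 eqxx /GRing.scale /= mulr1 expr1 mulKf ?pnatr_eq0.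
  by congr is_derive; apply/funext => t /=; rewrite mulrC.
have := is_deriveZ (beta^-1) (is_deriveB (is_derive_id s (1 : R)) (is_derive_theta s)).
have -> : beta^-1 *: (1 - expo s) = theta s.
  by rewrite expo_theta subKr /GRing.scale /= mulKf.
by congr is_derive; apply/funext => t /=; rewrite mulrC.
Qed.

Lemma le_theta s t : s <= t -> theta s <= theta t.
Proof.
move=> st; have [c [_ e]] := is_derive_mean is_derive_theta st.
by rewrite -subr_ge0 e mulr_ge0 ?subr_ge0 // ltW ?expo_gt0.
Qed.

Lemma theta_gt0 s : 0 < s -> 0 < theta s.
Proof.
move=> s0; have [c [_]] := is_derive_mean is_derive_theta (ltW s0).
by rewrite theta0 !subr0 => ->; rewrite mulr_gt0 ?expo_gt0.
Qed.

Lemma expoM2 s : expo (2 * s) = expo s ^+ 2.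
Proof. by rewrite /expo -mulrA -mulrN expRM_natl. Qed.

(** Together with [kappaM2], this relates values at 2 eps to values at eps, which makes the
    difference scheme exact on solutions of the equation. *)
Lemma thetaM2 s : theta (2 * s) = (1 + expo s) * theta s.
Proof.
rewrite /theta; case: eqVneq => [b0|b0].
  by rewrite /expo b0 mulr0 oppr0 expR0.
rewrite expoM2; field; exact: b0.
Qed.

Lemma kappaM2 s : kappa (2 * s) = (1 + expo s) * kappa s + s * theta s.
Proof.
rewrite /kappa thetaM2 expo_theta; case: eqVneq => [b0|b0].
  by rewrite /theta b0 eqxx; field.
field; exact: b0.
Qed.

Lemma a_minusE s : a_minus s beta = (theta s)^-1.
Proof. by rewrite /a_minus /theta /expo; case: eqVneq => // b0; rewrite invf_div. Qed.

Lemma a_plusE s : a_plus s beta = expo s / theta s.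
Proof.
rewrite /a_plus /theta /expo; case: eqVneq => [->|b0].
  by rewrite mulr0 oppr0 expR0 mul1r.
rewrite expRN; have := expR_gt0 (s * beta); set E := expR _ => E0.
(* Here s = 0, and both sides vanish because the inverse of 0 is 0. *)
have [E1|E1] := eqVneq E 1; first by rewrite E1 invr1 subrr mul0r invr0 mulr0 !mulr0.
field; rewrite b0 (gt_eqF E0) subr_eq0 E1 /=; lra.
Qed.

End OneDimensional.

(** * Radial quartic test functions *)

Section RadialQuartic.
Context {R : realType} {n : nat}.
Variables (x : 'rV[R]_n) (a b c : R).
Implicit Types (v w : 'rV[R]_n) (i j : 'I_n).

(** Being polynomial in the squared distance, it is smooth at [x] as well. Its coefficients suffice
    to prescribe a value and two radial derivatives at one positive distance. *)
Definition quartic w : R :=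
  a + b * edot (w - x) (w - x) + c * edot (w - x) (w - x) ^+ 2.

(** The radial derivative divided by the distance, that is, the factor of [w - x] in the
    gradient. *)
Let k w : R := 2 * b + 4 * c * edot (w - x) (w - x).

Lemma is_derive_coord w v i : is_derive w v (fun w : 'rV[R]_n => w 0 i) (v 0 i).
Proof.
have h : (fun t : R => t^-1 *: (((fun w : 'rV[R]_n => w 0 i) \o shift w) (t *: v) -
    (fun w : 'rV[R]_n => w 0 i) w)) @ 0^' --> v 0 i.
  apply: cvg_near_cst; near=> t.
  have t0 : t != 0 by near: t; exact: nbhs_dnbhs_neq.
  by rewrite /= !mxE addrK /GRing.scale /= mulKf.
by apply: DeriveDef; [exact: (cvgP _ h)|exact: cvg_lim].
Unshelve. all: by end_near. Qed.

Lemma is_derive_coordB w v i : is_derive w v (fun w : 'rV[R]_n => (w - x) 0 i) (v 0 i).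
Proof.
have := is_deriveB (is_derive_coord w v i) (is_derive_cst (x 0 i) w v).
by rewrite subr0; congr is_derive; apply/funext => t /=; rewrite !mxE.
Qed.

Lemma is_derive_sqr_edist w v :
  is_derive w v (fun w => edot (w - x) (w - x)) (2 * edot (w - x) v).
Proof.
have := is_derive_sum (fun i => is_deriveM (is_derive_coordB w v i) (is_derive_coordB w v i)).
have -> : \sum_i ((w - x) 0 i *: v 0 i + (w - x) 0 i *: v 0 i) = 2 * edot (w - x) v.
  by rewrite /edot mulr_sumr; apply: eq_bigr => i _; rewrite mulr_natl mulr2n.
by congr is_derive; apply/funext => t; rewrite fct_sumE.
Qed.

Lemma is_derive_quartic w v : is_derive w v quartic (k w * edot (w - x) v).
Proof.
have d := is_derive_sqr_edist w v.
have := is_deriveD (is_deriveD (is_derive_cst a w v) (is_deriveZ b d)) (is_deriveZ c (is_deriveX 2 d)).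
have e (Y D : R) : b * (2 * D) + c * (2 * Y * (2 * D)) = (2 * b + 4 * c * Y) * D by ring.
by congr is_derive; rewrite add0r /GRing.scale /= /k expr1; exact: e.
Qed.

Lemma is_derive_quartic2 w v i :
  is_derive w v (fun w => k w * (w - x) 0 i)
    (k w * v 0 i + 8 * c * edot (w - x) v * (w - x) 0 i).
Proof.
have d := is_deriveD (is_derive_cst (2 * b) w v) (is_deriveZ (4 * c) (is_derive_sqr_edist w v)).
have := is_deriveM d (is_derive_coordB w v i).
have e (p q D : R) : p * v 0 i + q * (4 * c * (2 * D)) = p * v 0 i + 8 * c * D * q by ring.
by congr is_derive; rewrite add0r /GRing.scale /= /k; exact: e.
Qed.

Lemma edot_evec p i : edot p (evec R i) = p 0 i.
Proof.
rewrite /edot (bigD1 i) //= mxE !eqxx mulr1 big1 ?addr0 // => j ji.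
by rewrite mxE (negbTE ji) andbF mulr0.
Qed.

Lemma pder_quartic i : pder quartic i = fun w => k w * (w - x) 0 i.
Proof.
by apply/funext => w; rewrite /pder (derive_val (is_derive := is_derive_quartic _ _)) edot_evec.
Qed.

Lemma pder2_quartic i j : pder (pder quartic i) j =
  fun w => k w * (i == j)%:R + 8 * c * (w - x) 0 j * (w - x) 0 i.
Proof.
rewrite pder_quartic; apply/funext => w.
by rewrite /pder (derive_val (is_derive := is_derive_quartic2 _ _ _)) edot_evec mxE eqxx.
Qed.

Lemma continuous_sqr_edist : continuous (fun w => edot (w - x) (w - x)).
Proof.
have -> : (fun w => edot (w - x) (w - x)) = (fun w => edist w x * edist w x).
  by apply/funext => w; rewrite -expr2 sqr_enorm.
by move=> w; exact: cvgM (@continuous_edist _ _ x w) (@continuous_edist _ _ x w).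
Qed.

Lemma continuous_coordB i : continuous (fun w => (w - x) 0 i).
Proof.
have -> : (fun w => (w - x) 0 i) = (fun w => w 0 i - x 0 i).
  by apply/funext => w; rewrite !mxE.
by move=> w; exact: cvgB (@coord_continuous R 1 n 0 i w) (cvg_cst _).
Qed.

Lemma continuous_k : continuous k.
Proof.
by move=> w; exact: cvgD (cvg_cst _) (cvgM (cvg_cst _) (@continuous_sqr_edist w)).
Qed.

Lemma C2_quartic : C2 quartic.
Proof.
have cp i : continuous (pder quartic i).
  by rewrite pder_quartic => w; exact: cvgM (@continuous_k w) (@continuous_coordB i w).
split; first split.
- move=> w; have cY := @continuous_sqr_edist w.
  exact: cvgD (cvgD (cvg_cst _) (cvgM (cvg_cst _) cY)) (cvgM (cvg_cst _) (cvgM cY cY)).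
- by move=> i; split=> // w; have [] := is_derive_quartic w (evec R i).
- move=> i; split=> // j; split.
    by rewrite pder_quartic => w; have [] := is_derive_quartic2 w (evec R j) i.
  rewrite pder2_quartic => w; have cB l := @continuous_coordB l w.
  exact: cvgD (cvgM (@continuous_k w) (cvg_cst _)) (cvgM (cvgM (cvg_cst _) (cB j)) (cB i)).
Qed.

Lemma grad_quartic w : grad quartic w = k w *: (w - x).
Proof. by apply/rowP => i; rewrite [LHS]mxE [RHS]mxE pder_quartic. Qed.

(** The Hessian is [k w] times the identity plus a rank-one matrix in the direction [w - x]. *)
Lemma qform_quartic w v :
  qform (hess quartic w) v = k w * edot v v + 8 * c * edot (w - x) v ^+ 2.
Proof.
have -> : hess quartic w = (k w)%:M + (8 * c) *: ((w - x)^T *m (w - x)).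
  by apply/matrixP => i j; rewrite !mxE big_ord1 pder2_quartic !mxE mulr_natr ord1; ring.
have mE (p q : 'rV[R]_n) : (p *m q^T) 0 0 = edot p q.
  by rewrite mxE; apply: eq_bigr => i _; rewrite mxE.
rewrite /qform mulmxDr mulmxDl mul_mx_scalar -scalemxAl -scalemxAr -scalemxAl (mulmxA v) -[v *m _ *m _ *m _]mulmxA.
rewrite [LHS]mxE; congr (_ + _); first by rewrite [LHS]mxE mE.
by rewrite [LHS]mxE [X in _ * X = _]mxE big_ord1 !mE (edotC v) expr2.
Qed.

(** A positive radial derivative makes the gradient a positive multiple of [w - x]; the operator
    then sees only the radial second derivative, and the sign against a normal depends on [w - x]
    alone. *)
Lemma quartic_noncritical w (s := edist w x) :
  0 < 2 * b * s + 4 * c * s ^+ 3 ->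
  [/\ inftylap_plus quartic w = 2 * b + 12 * c * s ^+ 2,
      enorm (grad quartic w) = 2 * b * s + 4 * c * s ^+ 3 &
      forall q, (0 < edot (grad quartic w) q) = (0 < edot (w - x) q)].
Proof.
have sE : s ^+ 2 = edot (w - x) (w - x) by rewrite sqr_enorm.
have -> : 2 * b * s + 4 * c * s ^+ 3 = s * k w by rewrite /k -sE; ring.
have s0 : 0 <= s := edist_ge0 _ _.
move=> p0; have s_gt0 : 0 < s.
  by rewrite lt_def s0 andbT; apply/eqP => e; rewrite e mul0r ltxx in p0.
have k0 : 0 < k w by rewrite pmulr_rgt0 in p0.
have gE : enorm (grad quartic w) = s * k w.
  by rewrite grad_quartic enormZ gtr0_norm // mulrC.
split=> // [|q]; last by rewrite grad_quartic edotZl pmulr_rgt0.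
rewrite /inftylap_plus -enorm_eq0 gE (gt_eqF p0) /= qform_quartic grad_quartic.
rewrite !edotZr edotZl -sE /k -sE in k0 *.
by field; rewrite (gt_eqF s_gt0) (gt_eqF k0).
Qed.

(** At the centre the Hessian is 2b times the identity, so its form is constant on the unit sphere;
    positive dimension makes that sphere nonempty. *)
Lemma quartic_critical : (0 < n)%N ->
  grad quartic x = 0 /\ inftylap_plus quartic x = 2 * b.
Proof.
move=> n0; have g0 : grad quartic x = 0 by rewrite grad_quartic subrr scaler0.
split=> //; rewrite /inftylap_plus g0 eqxx /=.
suff -> : [set qform (hess quartic x) v | v in [set v | enorm v = 1]] = [set 2 * b] by rewrite sup1.
have qE (v : 'rV[R]_n) : enorm v = 1 -> qform (hess quartic x) v = 2 * b.
  by move=> v1; rewrite qform_quartic /k subrr !edot0l -sqr_enorm v1; ring.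
apply/seteqP; split=> [_ [v /= v1 <-]|_ ->] /=; first exact: qE.
exists (evec R (Ordinal n0)); last apply: qE.
all: by rewrite /= /enorm edot_evec mxE !eqxx sqrtr1.
Qed.

End RadialQuartic.

(** * The normal to a convex set *)

Section ConvexNormal.
Context {R : realType} {n : nat}.
Implicit Types (f : 'rV[R]_n -> R) (v w x y : 'rV[R]_n) (i : 'I_n).

Lemma is_derive_line f v x (s : R) : (forall y, derivable f y v) ->
  is_derive s 1 (fun s : R => f (s *: v + x)) (derive f (s *: v + x) v).
Proof.
move=> fd; have := derivableP (fd (s *: v + x)).
have eqf : (fun h : R => h^-1 *: (((fun s : R => f (s *: v + x)) \o shift s) (h *: 1) - f (s *: v + x)))
    = (fun h : R => h^-1 *: ((f \o shift (s *: v + x)) (h *: v) - f (s *: v + x))).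
  apply/funext => h /=; congr (_ *: (f _ - _)).
  by rewrite -[h *: 1]/(h * 1) mulr1 scalerDl addrA.
by case=> fc fl; apply: DeriveDef; [rewrite /derivable eqf|rewrite /derive eqf].
Qed.

Lemma line_mean f v x (s : R) : (forall y, derivable f y v) ->
  exists c : R, `|c| <= `|s| /\ f (s *: v + x) - f x = derive f (c *: v + x) v * s.
Proof.
move=> fd; have fd' t := is_derive_line x t fd.
have [s0|/ltW s0] := leP 0 s.
  have [c [/andP[c0 cs] e]] := is_derive_mean fd' s0; exists c; split.
    by rewrite !ger0_norm.
  by move: e; rewrite scale0r add0r subr0.
have [c [/andP[cs c0] e]] := is_derive_mean fd' s0; exists c; split.
  by rewrite !ler0_norm // lerN2.
by move: e; rewrite scale0r add0r sub0r => e; rewrite -opprB e mulrN opprK.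
Qed.

(** [C1] speaks of partial derivatives only. The increment along [v] is split into moves along one
    coordinate at a time, each estimated by a mean value and the continuity of that partial
    derivative. *)
Lemma C1_directional f x v (e : R) : C1 f -> 0 < e ->
  exists d : R, 0 < d /\ forall t : R, 0 < t < d ->
    `|f (t *: v + x) - f x - t * edot (grad f x) v| <= t * e.
Proof.
move=> [_ f1] e0; pose M := \sum_i `|v 0 i|.
have M0 : 0 <= M by exact: sumr_ge0.
have vM i : `|v 0 i| <= M by rewrite /M (bigD1 i) //= lerDl sumr_ge0.
pose e1 := e / (1 + M); have M1 : 0 < 1 + M by lra.
have e10 : 0 < e1 by rewrite divr_gt0.
have Pd i : exists d : R, 0 < d /\ forall y, edist y x < d -> `|pder f i y - pder f i x| < e1.
  have /(_ x [set t | `|t - pder f i x| < e1]) ci := (f1 i).2.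
  apply/nbhs_edist; apply: ci; apply/nbhs_ballP; exists e1 => // t.
  by rewrite -ball_normE /= distrC.
have [d dP] := choice Pd.
pose d1 : R := \big[Num.min/1]_i d i.
have d10 : 0 < d1.
  by rewrite /d1; elim/big_ind : _ => // [a b a0 b0|i _]; [rewrite lt_min a0|exact: (dP i).1].
have close i y : edist y x < d1 -> `|pder f i y - pder f i x| < e1.
  by move=> yd; apply: (dP i).2; apply: (lt_le_trans yd); rewrite bigmin_le_cond.
have nM : 0 < 1 + n%:R * M by rewrite ltr_pwDl // mulr_ge0.
exists (d1 / (1 + n%:R * M)); split=> [|t /andP[t0 td]]; first by rewrite divr_gt0.
(* [vk k] keeps the first k coordinates of [v]. All intermediate points stay in the box of
   half-width [t * M] around [x], hence within [d1] of [x]. *)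
pose vk k : 'rV[R]_n := \row_i (if (i < k)%N then v 0 i else 0).
have near_x y : (forall i, `|y 0 i - x 0 i| <= t * M) -> edist y x < d1.
  move=> h; apply: le_lt_trans (edist_le_coord _ h) _; first by rewrite mulr_ge0 // ltW.
  by move: td; rewrite ltr_pdivlMr //; apply: le_lt_trans; rewrite mulrCA ler_pM2l // lerDr.
have step k : (k <= n)%N ->
    `|f (t *: vk k + x) - f x - t * \sum_(i < n | (i < k)%N) pder f i x * v 0 i|
    <= t * (e1 * \sum_(i < n | (i < k)%N) `|v 0 i|).
  elim: k => [_|k IHk kn].
    have -> : vk 0%N = 0 by apply/rowP => i; rewrite !mxE.
    by rewrite !big_pred0 // scaler0 add0r subrr !mulr0 subr0 normr0.
  pose i0 := Ordinal kn.
  have sumS (F : 'I_n -> R) :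
      \sum_(i < n | (i < k.+1)%N) F i = F i0 + \sum_(i < n | (i < k)%N) F i.
    rewrite (bigD1 i0) //=; congr (_ + _); apply: eq_bigl => i.
    by rewrite -val_eqE /= ltnS andbC ltn_neqAle.
  rewrite !sumS; have {}IHk := IHk (ltnW kn).
  have -> : t *: vk k.+1 + x = (t * v 0 i0) *: evec R i0 + (t *: vk k + x).
    apply/rowP => i; rewrite !mxE eqxx /= addrA; congr (_ + _).
    rewrite -val_eqE /= ltnS leq_eqVlt; case: (eqVneq (i : nat) k) => [ik|ik] /=.
      by rewrite ik ltnn mulr0 addr0 mulr1 (_ : i0 = i) //; apply: val_inj; rewrite /= ik.
    by rewrite mulr0 add0r.
  have [c [cs fc]] := @line_mean f (evec R i0) (t *: vk k + x) (t * v 0 i0) (f1 i0).1.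
  rewrite normrM (gtr0_norm t0) in cs.
  have /(close i0) : edist (c *: evec R i0 + (t *: vk k + x)) x < d1.
    apply: near_x => i; rewrite !mxE eqxx /= addrA addrK.
    rewrite -val_eqE /=; case: (eqVneq (i : nat) k) => [ik|ik].
      rewrite ik ltnn mulr0 addr0 mulr1 (le_trans cs) // ler_pM2l //.
    rewrite mulr0 add0r normrM (gtr0_norm t0) ler_pM2l //.
    by case: ifP => // _; rewrite normr0.
  rewrite -/(pder f i0 _) in fc.
  move: fc; set D := pder f i0 (_ + _); set a := f (_ + (_ + _)); set b := f (_ + x) in IHk *.
  move: IHk; set S := \sum_(i < n | _) _; set T := \sum_(i < n | _) _ => IHk fc Dx.
  have -> : a - f x - t * (pder f i0 x * v 0 i0 + S) =
    (b - f x - t * S) + (D - pder f i0 x) * (t * v 0 i0).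
    by rewrite mulrBl -fc; ring.
  apply: le_trans (ler_normD _ _) _; rewrite 2!mulrDr addrC lerD //.
  by rewrite normrM normrM (gtr0_norm t0) mulrCA ler_pM2l // ler_wpM2r // ltW.
have := step n (leqnn n).
have -> : vk n = v by apply/rowP => i; rewrite mxE ltn_ord.
have sumn (F : 'I_n -> R) : \sum_(i < n | (i < n)%N) F i = \sum_i F i.
  by apply: eq_bigl => i; rewrite ltn_ord.
rewrite !sumn -/M; have -> : \sum_i pder f i x * v 0 i = edot (grad f x) v.
  by apply: eq_bigr => i _; rewrite mxE.
move=> h; apply: (le_trans h); rewrite ler_pM2l // /e1 mulrAC ler_pdivrMr //.
by rewrite ler_pM2l // lerDr.
Qed.

Lemma C1_directional_le0 f x v : C1 f ->
  (exists d : R, 0 < d /\ forall t, 0 < t < d -> f (t *: v + x) <= f x) ->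
  edot (grad f x) v <= 0.
Proof.
move=> f1 [d [d0 fd]]; rewrite leNgt; apply/negP => g0.
have e0 : 0 < edot (grad f x) v / 2 by rewrite divr_gt0.
have [d' [d'0 h]] := C1_directional x v f1 e0.
pose t := Num.min d d' / 2.
have m0 : 0 < Num.min d d' by rewrite lt_min d0.
have t0 : 0 < t by rewrite divr_gt0.
have : t < Num.min d d' by rewrite /t; lra.
rewrite lt_min => /andP[td td'].
have := fd t; rewrite t0 td => /(_ isT); have := h t; rewrite t0 td' => /(_ isT).
have : 0 < t * edot (grad f x) v by rewrite mulr_gt0.
by rewrite ler_norml; lra.
Qed.

(* Near a boundary point [w] of a convex set, points of the segments from [w]
   to the set are limits of points of the set; moving [x] a little along the
   normal makes the resulting inequality strict. *)
Lemma convex_normal_gt0 (O : set 'rV[R]_n) nu x w :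
  open O -> convex_set_ O -> C1_boundary_normal O nu -> O x -> bdry O w ->
  0 < edot (w - x) (nu w).
Proof.
move=> oO cO nO Ox bw; have [r [rho [r0 [rho1 [Orho [grho ->]]]]]] := nO w bw.
have [cw niw] := bw; have nOw : ~ O w by move=> Ow; apply: niw; exact: open_nbhs_nbhs.
have crho := rho1.1.
(* [rho] is negative on [O] near [w], and continuity extends the weak inequality to the closure. *)
have rho_le0 z : edist z w < r -> closure O z -> rho z <= 0.
  move=> zr cz; rewrite leNgt; apply/negP => z0.
  have : nbhs z [set y | 0 < rho y /\ edist y w < r].
    have /(crho z) h1 : nbhs (rho z) [set y | 0 < y].
      by apply: open_nbhs_nbhs; split=> //; exact: open_gt.
    have /(@continuous_edist _ _ w z) h2 : nbhs (edist z w) [set y | y < r].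
      by apply: open_nbhs_nbhs; split=> //; exact: open_lt.
    by apply: filterI; [exact: h1|exact: h2].
  move=> /cz [y [Oy [y0 yr]]]; have := (Orho y yr).1 Oy; lra.
have ww : edist w w < r by rewrite edistxx.
have w0 : rho w = 0.
  apply/eqP; rewrite eq_le rho_le0 //= leNgt; apply/negP => h.
  by apply: nOw; apply/(Orho w ww).
have g0 := grho w ww w0; set g := grad rho w in g0 *.
have gg : 0 < edot g g by rewrite lt_def edot_eq0 g0 edot_ge0.
have dir x' : O x' -> edot g (x' - w) <= 0.
  move=> Ox'; apply: C1_directional_le0 => //.
  have D0 : 0 <= edist x' w := edist_ge0 _ _.
  exists (Num.min 1 (r / (1 + edist x' w))); split; first by rewrite lt_min ltr01 divr_gt0 //; lra.
  move=> t; rewrite lt_min => /and3P[t0 t1]; rewrite ltr_pdivlMr; last lra.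
  move=> tr; rewrite w0; have -> : t *: (x' - w) + w = (1 - t) *: w + t *: x'.
    by rewrite scalerBr scalerBl scale1r [RHS]addrC -addrA [- _ + w]addrC.
  apply: rho_le0; first by rewrite edist_segment ?ltW //; nra.
  by apply: closure_convex => //; [exact: subset_closure|rewrite !ltW].
have /nbhs_edist [d [d0 dO]] : nbhs x O by exact: open_nbhs_nbhs.
(* The shift [s *: g] has length d / 2, so the shifted point stays in [O]. *)
pose s := d / (2 * enorm g).
have ng0 : 0 < enorm g by rewrite lt_def enorm_eq0 g0 enorm_ge0.
have s0 : 0 < s by rewrite divr_gt0 // mulr_gt0.
have /dir : O (x + s *: g).
  apply: dO; rewrite /edist addrC addKr enormZ gtr0_norm // /s invfM mulrA mulfVK ?gt_eqF //; lra.
rewrite edotZr pmulr_rgt0 ?invr_gt0 //.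
have gN p : edot g (- p) = - edot g p by rewrite edotC edotNl edotC.
have : 0 < s * edot g g by rewrite mulr_gt0.
rewrite (edotC _ g) !edotDr !gN edotZr; lra.
Qed.

End ConvexNormal.

(** * Comparison with radial profiles *)

Section Profile.
Context {R : realType}.
Variables beta m gam C : R.
Implicit Types (s t : R).

(** The solution of g'' + beta g' = - C with value [m] and slope [gam] at 0. *)
Definition profile s : R := m + gam * theta beta s - C * kappa beta s.
Definition slope s : R := gam * expo beta s - C * theta beta s.

Lemma is_derive_profile s : is_derive s 1 profile (slope s).
Proof.
have := is_deriveB (is_deriveD (is_derive_cst m s (1 : R)) (is_deriveZ gam (is_derive_theta beta s)))
  (is_deriveZ C (is_derive_kappa beta s)).
by rewrite add0r.
Qed.

Lemma is_derive_slope s : is_derive s 1 slope (- C - beta * slope s).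
Proof.
have := is_deriveB (is_deriveZ gam (is_derive_expo beta s)) (is_deriveZ C (is_derive_theta beta s)).
have e (E T : R) : E = 1 - beta * T ->
  gam * (- beta * E) - C * E = - C - beta * (gam * E - C * T) by move=> ->; ring.
by congr is_derive; exact: e (expo_theta beta s).
Qed.

(** Eliminating [gam] between the values at s and 2s leaves the three-point identity behind the
    difference scheme. *)
Lemma profileM2 s : profile (2 * s) =
  m + (1 + expo beta s) * (profile s - m) - C * (s * theta beta s).
Proof. by rewrite /profile thetaM2 kappaM2; ring. Qed.

(** For C >= 0 the quotient of the slope by [expo] is nonincreasing; the proof is the
    cross-multiplied form of this. *)
Lemma slope_le0 s t : 0 <= C -> s <= t -> slope s <= 0 -> slope t <= 0.
Proof.
move=> C0 st; rewrite /slope !subr_le0 => hs.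
have [Es Et] := (expo_gt0 beta s, expo_gt0 beta t).
rewrite -(ler_pM2l Es).
have h1 : gam * expo beta s * expo beta t <= C * theta beta s * expo beta t by rewrite ler_pM2r.
have h2 : 0 <= C * (theta beta t - theta beta s) by rewrite mulr_ge0 ?subr_ge0 ?le_theta.
have : expo beta s * (C * theta beta t) - C * theta beta s * expo beta t =
  C * (theta beta t - theta beta s) by rewrite !expo_theta; ring.
lra.
Qed.

Lemma profile_nonincreasing s t : 0 <= C -> s <= t -> slope s <= 0 -> profile t <= profile s.
Proof.
move=> C0 st hs; have [c [/andP[sc ct] e]] := is_derive_mean is_derive_profile st.
by rewrite -subr_le0 e mulr_le0_ge0 ?subr_ge0 // (slope_le0 C0 sc).
Qed.

End Profile.

(** * Testing the subsolution with radial functions *)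

Section Viscosity.
Context {R : realType} {n : nat}.
Variables (O A : set 'rV[R]_n) (nu : 'rV[R]_n -> 'rV[R]_n) (beta : R) (h u : 'rV[R]_n -> R).
Let GN := bdry O `&` A.
Hypotheses (n_gt0 : (0 < n)%N) (oO : open O) (nuO : C1_boundary_normal O nu)
  (cvxO : GN !=set0 -> convex_set_ O) (subsol : visc_subsol O GN nu beta h u).
Implicit Types (x y w : 'rV[R]_n) (s t : R).

Definition local_max (f : 'rV[R]_n -> R) w :=
  exists r : R, 0 < r /\ forall y, closure O y -> edist y w < r -> f y <= f w.

(** The Neumann alternative is excluded in both cases: the vertex is an interior point, and
    elsewhere the gradient is a positive multiple of [w - x], which has positive product with the
    normal. *)
Lemma quartic_test x w (a b c : R) (s := edist w x) : O x -> (O `|` GN) w ->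
  local_max (fun y => u y - quartic x a b c y) w ->
  w = x \/ 0 < 2 * b * s + 4 * c * s ^+ 3 ->
  - (2 * b + 12 * c * s ^+ 2) - beta * (2 * b * s + 4 * c * s ^+ 3) <= h w.
Proof.
move=> Ox Ow mx xw; have [] := subsol.2 _ w (C2_quartic x a b c) Ow mx.
  case: xw => [wx|p0]; last by have [-> ->] := quartic_noncritical a p0.
  rewrite {}/s wx edistxx; have [-> ->] := quartic_critical x a b c n_gt0.
  by rewrite enorm0 !expr0n /= !mulr0 !addr0 mulr0.
move=> [GNw]; case: xw => [wx|p0].
  by case: GNw => -[_ niw] _; exfalso; apply: niw; rewrite wx; exact: open_nbhs_nbhs.
have [_ _ gE] := quartic_noncritical a p0; rewrite leNgt gE.
by rewrite (convex_normal_gt0 oO) //; [apply: cvxO; exists w|case: GNw].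
Qed.

(* The radial function [g (edist _ x)] is singular at [x] and is not [C2]
   globally: it is touched from above by an even quartic in the distance whose
   second derivative exceeds that of [g] by an arbitrarily small [e]. *)
Lemma radial_test (g g1 g2 : R -> R) x w (s := edist w x) :
  (forall t : R, is_derive t 1 g (g1 t)) -> (forall t : R, is_derive t 1 g1 (g2 t)) ->
  {for s, continuous g2} -> O x -> (O `|` GN) w ->
  local_max (fun y => u y - g (edist y x)) w ->
  (w = x /\ g1 0 = 0) \/ (0 < s /\ 0 < g1 s) -> - g2 s - beta * g1 s <= h w.
Proof.
move=> dg dg1 cg2 Ox Ow [r [r0 mx]] xw; apply/ler_addgt0Pr => e e0.
(* The slope is matched and the second derivative exceeded by [e]: a 2 by 2 linear system when s >
   0, a paraboloid (c = 0) at the vertex. *)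
have [b [c [b1 b2]]] : exists b c : R,
    2 * b * s + 4 * c * s ^+ 3 = g1 s /\ 2 * b + 12 * c * s ^+ 2 = g2 s + e.
  case: xw => [[wx g10]|[s0 _]].
    by exists ((g2 s + e) / 2), 0; rewrite /s wx edistxx g10; split; field.
  pose c := (g2 s + e - g1 s / s) / (8 * s ^+ 2).
  exists ((g1 s - 4 * c * s ^+ 3) / (2 * s)), c.
  by split; rewrite /c; field; rewrite ?(gt_eqF s0).
pose a := g s - b * s ^+ 2 - c * s ^+ 4.
pose p t : R := a + b * t ^+ 2 + c * t ^+ 4.
have quarticE y : quartic x a b c y = p (edist y x).
  by rewrite /quartic /p -sqr_enorm -exprM.
pose p1 t : R := 2 * b * t + 4 * c * t ^+ 3.
pose p2 t : R := 2 * b + 12 * c * t ^+ 2.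
have dX k t := is_deriveX k (is_derive_id t (1 : R)).
have dp t : is_derive t 1 p (p1 t).
  have := is_deriveD (is_deriveD (is_derive_cst a t (1 : R)) (is_deriveZ b (dX 2 t))) (is_deriveZ c (dX 4 t)).
  have E : b * (2 * t ^+ 1 * 1) + c * (4 * t ^+ 3 * 1) = p1 t by rewrite /p1; ring.
  by congr is_derive; rewrite add0r; exact: E.
have dp1 t : is_derive t 1 p1 (p2 t).
  have := is_deriveD (is_deriveZ (2 * b) (is_derive_id t (1 : R))) (is_deriveZ (4 * c) (dX 3 t)).
  have E : 2 * b * 1 + 4 * c * (3 * t ^+ 2 * 1) = p2 t by rewrite /p2; ring.
  by congr is_derive; exact: E.
have dp2 t : is_derive t 1 p2 (24 * c * t).
  have := is_deriveD (is_derive_cst (2 * b) t (1 : R)) (is_deriveZ (12 * c) (dX 2 t)).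
  have E : 12 * c * (2 * t ^+ 1 * 1) = 24 * c * t by ring.
  by congr is_derive; rewrite add0r; exact: E.
have [||||d [d0 pg]] := @second_order_local_min R (p \- g) (p1 \- g1) (p2 \- g2) s
  (fun t => is_deriveB (dp t) (dg t)) (fun t => is_deriveB (dp1 t) (dg1 t)).
- exact: cvgB (is_derive_continuous (dp2 s)) cg2.
- by rewrite /= /p /a; ring.
- by rewrite /= /p1 b1 subrr.
- by rewrite /= /p2 b2 addrAC subrr add0r.
have := @quartic_test x w a b c Ox Ow.
rewrite -/s b1 b2 => H; suff : - (g2 s + e) - beta * g1 s <= h w by lra.
apply: H; last by case: xw => [[]|[]]; [left|right].
exists (Num.min r d); split=> [|y cy]; first by rewrite lt_min r0.
rewrite lt_min !quarticE => /andP[yr yd].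
have ps : p s = g s by rewrite /p /a; ring.
have := mx y cy yr; rewrite -/s ps.
(* The distance to [x] is 1-Lipschitz. *)
have /pg /= : `|edist y x - s| < d; last by lra.
rewrite ltr_norml; have := edist_triangle w y x; have := edist_triangle y w x.
rewrite (edistC w y) -/s; lra.
Qed.

(** The equation solved by the profile turns the left-hand side of [radial_test] into [C]. At the
    vertex the slope is [gam]. *)
Lemma profile_test m gam C x w (s := edist w x) : O x -> (O `|` GN) w ->
  local_max (fun y => u y - profile beta m gam C (edist y x)) w ->
  (w = x /\ gam = 0) \/ (0 < s /\ 0 < slope beta gam C s) -> C <= h w.
Proof.
move=> Ox Ow mx xw.
have cs : {for s, continuous (fun t => - C - beta * slope beta gam C t)}.
  have := is_derive_continuous (is_deriveB (is_derive_cst (- C) s (1 : R))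
    (is_deriveZ beta (is_derive_slope beta gam C s))).
  exact.
have := radial_test (is_derive_profile beta m gam C) (is_derive_slope beta gam C) cs Ox Ow mx.
rewrite -/s opprB -addrA addrCA opprK subrr addr0; apply.
case: xw => [[-> ->]|]; [left|by right]; split=> //.
by rewrite /slope theta0 mul0r mulr0 subrr.
Qed.

Lemma profile_comparison (eps M C : R) x y : 0 < eps -> cont_on (O `|` GN) u ->
  trace_ball O (2 * eps) x `<=` O `|` GN -> closure O x ->
  trace_ball O eps x y ->
  (forall w, trace_ball O (2 * eps) x w -> u w <= M) ->
  (forall w, trace_ball O (2 * eps) x w -> h w <= C) ->
  expo beta eps * (u y - u x) - (M - u y) <= C * (eps * theta beta eps).
Proof.
move=> e0 cu; set K := trace_ball _ _ _ => KO cx [cy yx] uM hC.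
set E := expo _ _; set T := theta _ _; rewrite leNgt; apply/negP => lt.
have E0 : 0 < E := expo_gt0 _ _; have T0 : 0 < T := theta_gt0 _ e0.
have eT0 : 0 < eps * T by rewrite mulr_gt0.
have Kx : K x by split=> //; rewrite edistxx; lra.
have Ky : K y by split=> //; lra.
have [uxM uyM] := (uM x Kx, uM y Ky).
(* The excess [del] is spent in quarters: one on raising C to [C'], two on the shifts by [eta] at 0
   and eps. The last, [(1 + E) * eta], exceeds [eta] and yields the margin in [g2e]. *)
pose del := E * (u y - u x) - (M - u y) - C * (eps * T).
have del0 : 0 < del by rewrite subr_gt0.
pose C' := C + del / (4 * (eps * T)).
have CC' : C < C' by rewrite ltrDl divr_gt0 // mulr_gt0.
have C'E : C' * (eps * T) = C * (eps * T) + del / 4.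
  by rewrite /C'; field; rewrite !gt_eqF.
pose eta := del / (4 * (1 + E)).
have E1 : 0 < 1 + E by lra.
have eta0 : 0 < eta by rewrite divr_gt0 // mulr_gt0.
have etaE : (1 + E) * eta = del / 4 by rewrite /eta; field; rewrite gt_eqF.
(* The initial slope that gives g(eps) = u(y) - eta once g(0) = u(x) + eta. *)
pose gam := (u y - u x - 2 * eta + C' * kappa beta eps) / T.
pose g := profile beta (u x + eta) gam C'.
have g0 : g 0 = u x + eta by rewrite /g /profile theta0 kappa0 !mulr0 subr0 addr0.
have ge : g eps = u y - eta by rewrite /g /profile /gam divfK ?gt_eqF //; lra.
have g2e : M + 2 * eta < g (2 * eps).
  rewrite /g profileM2 -/g ge -/E -/T C'E.
  have -> : (1 + E) * (u y - eta - (u x + eta)) = (1 + E) * (u y - u x) - 2 * ((1 + E) * eta) by ring.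
  have : 0 < E * eta by rewrite mulr_gt0.
  rewrite etaE; move: etaE; rewrite /del; lra.
have cg t := is_derive_continuous (is_derive_profile beta (u x + eta) gam C' t).
have [d1 [d10 gd1]] : exists d : R, 0 < d /\ forall t, `|t - eps| < d -> g t < u y.
  have /(cg eps) : nbhs (g eps) [set t | t < u y].
    by apply: open_nbhs_nbhs; split; [exact: open_lt|rewrite /= ge; lra].
  exact: near_real.
have [d2 [d20 gd2]] : exists d : R, 0 < d /\ forall t, `|t - 2 * eps| < d -> M + 2 * eta < g t.
  have /(cg (2 * eps)) : nbhs (g (2 * eps)) [set t | M + 2 * eta < t].
    by apply: open_nbhs_nbhs; split; [exact: open_gt|].
  exact: near_real.
have [d3 [d30 ud3]] := cu x (KO x Kx) _ eta0.
pose d := Num.min (Num.min d1 d2) (Num.min d3 eps).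
have d0 : 0 < d by rewrite !lt_min d10 d20 d30.
(* [x] may lie on the Neumann boundary, whereas the test lemmas need a vertex in [O]. *)
have [x' [Ox']] := (closureP O x).1 cx d d0.
rewrite !lt_min => /andP[/andP[xd1 xd2] /andP[xd3 xe]].
have Kx' : K x' by split; [exact: subset_closure|lra].
have ux' : `|u x' - u x| < eta by apply: ud3 => //; exact: KO.
have {ux'} /andP[ux'l ux'r] : - eta < u x' - u x < eta by rewrite -ltr_norml.
have sphere w : K w -> ~ edist w x < 2 * eps -> M + 2 * eta < g (edist w x').
  move=> [_ wx] nwx; apply: gd2; rewrite ltr_norml.
  have := edist_triangle x' w x; have := edist_triangle x w x'.
  rewrite (edistC x x'); lra.
have cprof m ga : continuous (fun w => profile beta m ga C' (edist w x')).
  move=> w; apply: (@continuous_comp _ _ _ (fun w => edist w x') (profile beta m ga C')).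
    exact: continuous_edist.
  exact: is_derive_continuous (is_derive_profile _ _ _ _ _).
have maxK m ga : exists w, K w /\ forall z, K z ->
    u z - profile beta m ga C' (edist z x') <= u w - profile beta m ga C' (edist w x').
  apply: usc_max; [exact: compact_trace_ball|by exists x|].
  by apply: usc_subl => //; apply: sub_usc_on KO _; exact: cont_usc.
(* A maximum in the open ball at an admissible point would give C' <= h(w) <= C < C'. *)
have absurd m ga w : K w -> edist w x < 2 * eps -> (forall z, K z ->
    u z - profile beta m ga C' (edist z x') <= u w - profile beta m ga C' (edist w x')) ->
    ~ ((w = x' /\ ga = 0) \/ (0 < edist w x' /\ 0 < slope beta ga C' (edist w x'))).
  move=> Kw wx mw side; have := profile_test (m := m) Ox' (KO w Kw) _ side.
  have := hC w Kw => hw H; have {H} : C' <= h w; last by lra.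
  apply: H; exists (2 * eps - edist w x); split=> [|z cz zw]; first by lra.
  by apply: mw; split=> //; have := edist_triangle w z x; lra.
have pos w : w != x' -> 0 < edist w x' by move=> wx'; rewrite lt_def edist_eq0 wx' edist_ge0.
(* If [C'] and [gam] are both negative, [g] first decreases. The profile with zero initial slope is
   increasing and lies above [g - eta], so it still beats [u] on the outer sphere. *)
have [side|/not_orP [/negP nC /negP ng]] := pselect (0 <= C' \/ 0 <= gam); last first.
  rewrite -ltNge in nC; rewrite -ltNge in ng.
  have [w [Kw mw]] := maxK (u x) 0; apply: (absurd _ _ w Kw _ mw).
    apply: contrapT => /(sphere w Kw); have := mw x' Kx'; have := uM w Kw.
    rewrite /g /profile edistxx theta0 kappa0 !mul0r !mulr0 !addr0 subr0.
    have : gam * theta beta (edist w x') <= 0.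
      by rewrite mulr_le0_ge0 ?(ltW ng) // -(theta0 beta) le_theta ?edist_ge0.
    lra.
  have [wx'|/pos wx'] := eqVneq w x'; [by left|right]; split=> //.
  by rewrite /slope mul0r sub0r -mulNr mulr_gt0 ?oppr_gt0 ?theta_gt0.
(* For C' >= 0, a negative slope before eps would persist and force g(2 eps) <= g(eps) < M. For C' <
   0 both terms of the slope are nonnegative. *)
have ginc s : 0 <= s <= eps -> g s <= g eps.
  move=> /andP[s0 se].
  have [c [/andP[sc ce] eg]] := is_derive_mean (is_derive_profile beta (u x + eta) gam C') se.
  rewrite -subr_ge0 eg mulr_ge0 //; last by rewrite subr_ge0.
  rewrite leNgt; apply/negP => sl.
  have [C0|C0] := leP 0 C'.
    have e2 : eps <= 2 * eps by lra.
    have := profile_nonincreasing (u x + eta) C0 e2 (slope_le0 C0 ce (ltW sl)).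
    by rewrite -/g; lra.
  case: side => [|ga0]; first by lra.
  move: sl; rewrite /slope ltNge => /negP; apply.
  have : 0 <= gam * expo beta c by rewrite mulr_ge0 // ltW ?expo_gt0.
  have : 0 <= - C' * theta beta c.
    by rewrite mulr_ge0 //; [lra|rewrite -(theta0 beta) le_theta // (le_trans s0)].
  by rewrite mulNr; lra.
have [w [Kw mw]] := maxK (u x + eta) gam.
(* The point [y] already makes u - g positive: its distance to [x'] is at most eps, where [ginc]
   applies, or exceeds eps by less than [d1]. *)
have w_pos : g (edist w x') < u w.
  have := mw y Ky; rewrite -/g; suff : g (edist y x') < u y by lra.
  have yx' : edist y x' < eps + d1.
    by have := edist_triangle x y x'; rewrite (edistC x x'); lra.
  have [ye|ye] := leP (edist y x') eps.
    by apply: le_lt_trans (ginc _ _) _; rewrite ?edist_ge0 // ge; lra.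
  by apply: gd1; rewrite ltr_norml; lra.
have wx : edist w x < 2 * eps.
  by apply: contrapT => /(sphere w Kw); have := uM w Kw; lra.
have wx' : w != x'.
  by apply/eqP => e; move: w_pos; rewrite e edistxx g0; lra.
apply: (absurd _ _ w Kw wx mw); right; split; first exact: pos.
have s0 := pos w wx'; set s := edist w x' in s0 w_pos *.
have uw := uM w Kw.
have [C0|C0] := leP 0 C'; last first.
  case: side => [|ga0]; first by lra.
  have : 0 <= gam * expo beta s by rewrite mulr_ge0 // ltW ?expo_gt0.
  have : 0 < - C' * theta beta s by rewrite mulr_gt0 ?theta_gt0 //; lra.
  by rewrite /slope mulNr; lra.
(* Were the slope nonpositive at s, [g] would not increase up to 2 eps, so g(s) > M >= u(w), against
   [w_pos]. *)
rewrite ltNge; apply/negP => sl.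
have se : s <= 2 * eps.
  rewrite leNgt; apply/negP => es.
  have /gd2 : `|s - 2 * eps| < d2; last by lra.
  by have := edist_triangle x w x'; rewrite ltr_norml (edistC x x') -/s; lra.
have := profile_nonincreasing (u x + eta) C0 se sl; rewrite -/g; lra.
Qed.

End Viscosity.

(** * Sup- and inf-envelopes *)

Section Envelopes.
Context {R : realType} {n : nat}.
Implicit Types (O S : set 'rV[R]_n) (f : 'rV[R]_n -> R) (x y z : 'rV[R]_n) (r M : R).

(** In dimension 0 the space is one point, so no open set has a boundary. *)
Lemma dim_gt0 O : open O -> bdry O !=set0 -> (0 < n)%N.
Proof.
move: O; case: n => // O oO [x [/closureP cx nix]]; exfalso; apply: nix.
have [y [Oy _]] := cx 1 ltr01; apply: open_nbhs_nbhs; split=> //.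
by rewrite (_ : x = y) //; apply/rowP => -[].
Qed.

Lemma setdist_le S x y : S y -> setdist x S <= edist x y.
Proof.
by move=> Sy; apply: ge_inf; [exists 0 => _ [z _ <-]; exact: edist_ge0|exists y].
Qed.

Lemma trace_ball_trans O r s x y z :
  trace_ball O s x y -> trace_ball O r y z -> trace_ball O (r + s) x z.
Proof. by move=> [_ yx] [cz zy]; split=> //; have := edist_triangle y z x; lra. Qed.

Lemma supB_le O r f x M : closure O x -> 0 <= r ->
  (forall y, trace_ball O r x y -> f y <= M) -> supB O r f x <= M.
Proof.
move=> cx r0 fM; apply: ge_sup => [|_ [y xy <-]]; last exact: fM.
by exists (f x), x => //; split; rewrite ?edistxx.
Qed.

(** The bound [M] guarantees that the [sup] is a genuine supremum and not its default value. *)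
Lemma le_supB O r f x y M : trace_ball O r x y ->
  (forall y, trace_ball O r x y -> f y <= M) -> f y <= supB O r f x.
Proof.
move=> xy fM; apply: ub_le_sup; last by exists y.
by exists M => _ [z xz <-]; exact: fM.
Qed.

(** The supremum of the parameters whose points lie in the closure gives a boundary point: it is in
    the closure, and if it were interior a slightly larger parameter would qualify. *)
Lemma segment_bdry O x y : closure O x -> ~ closure O y ->
  exists t, 0 <= t <= 1 /\ bdry O ((1 - t) *: x + t *: y).
Proof.
move=> cx ncy; pose p (t : R) := (1 - t) *: x + t *: y.
have D0 : 0 <= edist y x := edist_ge0 _ _.
have D1 : 0 < 1 + edist y x by lra.
have pE s t : edist (p t) (p s) = `|t - s| * edist y x.
  rewrite /edist -enormZ; congr enorm.
  by apply/rowP => i; rewrite !mxE; ring.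
pose T : set R := [set t | 0 <= t <= 1 /\ closure O (p t)].
have T0 : T 0 by split; rewrite ?lexx ?ler01 // /p subr0 scale1r scale0r addr0.
have hT : has_sup T by split; [exists 0|exists 1 => t [/andP[]]].
pose s := sup T.
have s0 : 0 <= s := sup_upper_bound hT T0.
have s1 : s <= 1 by apply: ge_sup; [exists 0|move=> t [/andP[]]].
have cps : closure O (p s).
  apply: closed_closure => U /nbhs_edist [d [d0 dU]].
  have dD : 0 < d / (1 + edist y x) by rewrite divr_gt0.
  have [t Tt st] := sup_adherent dD hT; have ts := sup_upper_bound hT Tt.
  exists (p t); split; first by case: Tt.
  apply: dU; rewrite pE distrC ger0_norm ?subr_ge0 //.
  have : s - t < d / (1 + edist y x) by rewrite -/s in st; lra.
  by rewrite ltr_pdivlMr //; have : t <= s := ts; nra.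
exists s; split; first by rewrite s0.
split=> // /nbhs_edist [d [d0 dO]].
have sn1 : s < 1.
  rewrite lt_neqAle s1 andbT; apply/eqP => e; apply: ncy; move: cps.
  by rewrite e /p subrr scale0r scale1r add0r.
pose t := s + Num.min (1 - s) (d / (1 + edist y x)) / 2.
have m0 : 0 < Num.min (1 - s) (d / (1 + edist y x)) by rewrite lt_min subr_gt0 sn1 divr_gt0.
have : Num.min (1 - s) (d / (1 + edist y x)) / 2 < Num.min (1 - s) (d / (1 + edist y x)) by lra.
rewrite lt_min ltr_pdivlMr // => /andP[h1 h2].
have /(sup_upper_bound hT) : T t.
  split; first by rewrite /t; lra.
  apply: subset_closure; apply: dO; rewrite pE /t addrAC subrr add0r gtr0_norm ?divr_gt0 //.
  by lra.
by rewrite -/s /t; lra.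
Qed.

(** The Euclidean midpoint works. It is in the closure by convexity, or because otherwise the
    segment from [x] would meet the boundary within distance [r]. *)
Lemma midpoint_trace_ball O x z r :
  convex_set_ O \/ (forall y, bdry O y -> r < edist x y) ->
  closure O x -> trace_ball O (2 * r) x z ->
  exists y, trace_ball O r x y /\ trace_ball O r y z.
Proof.
move=> hO cx [cz zx]; pose y := (1 - 2^-1) *: x + 2^-1 *: z.
have half0 : (0 : R) <= 2^-1 by rewrite invr_ge0.
have yx : edist y x <= r by rewrite edist_segment //; lra.
have zy : edist z y <= r.
  have -> : y = (1 - 2^-1) *: z + 2^-1 *: x.
    by apply/rowP => i; rewrite !mxE; field.
  by rewrite edistC edist_segment // edistC; lra.
suff cy : closure O y by exists y.
case: hO => [cO|far]; first by apply: closure_convex => //; lra.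
apply: contrapT => /(segment_bdry cx) [t [/andP[t0 t1]]] /far.
by rewrite edistC edist_segment //; have := edist_ge0 y x; nra.
Qed.

End Envelopes.

(** * Maximizers on the two balls and the difference inequality *)

Theorem theorem2p2 (R : realType) (n : nat) (Omega A : set 'rV[R]_n)
  (nu : 'rV[R]_n -> 'rV[R]_n) (beta : R) (h u : 'rV[R]_n -> R) :
  open Omega -> ebounded Omega -> connected Omega ->
  C1_boundary_normal Omega nu ->
  open A ->
  let GN := bdry Omega `&` A in
  let GD := bdry Omega `\` A in
  GD !=set0 ->
  (GN !=set0 -> convex_set_ Omega) ->
  usc_on (Omega `|` GN) h ->
  cont_on (Omega `|` GN) u ->
  visc_subsol Omega GN nu beta h u ->
  forall eps : R, 0 < eps ->
  forall x, Omega_eps Omega GD (2 * eps) x ->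
    a_plus eps beta * Sminus Omega eps (supB Omega eps u) x
    - a_minus eps beta * Splus Omega eps (supB Omega eps u) x
    <= supB Omega (2 * eps) h x.
Proof.
move=> oO _ _ nuO oA GN GD GD0 cvx uh cu sub eps e0 x [cx xGD].
have n0 : (0 < n)%N by have [z [bz _]] := GD0; apply: (dim_gt0 oO); exists z.
pose K := trace_ball Omega (2 * eps) x.
have KO : K `<=` Omega `|` GN.
  move=> y [cy yx]; have [Oy|nOy] := pselect (Omega y); [by left|right].
  have by_ : bdry Omega y by split=> // /interior_subset.
  split=> //; apply: contrapT => nAy.
  have := @setdist_le R n GD x y (conj by_ nAy); rewrite edistC; lra.
have cK : compact K by exact: compact_trace_ball.
have Kx : K x by split=> //; rewrite edistxx; lra.
have Bx : trace_ball Omega eps x x by split=> //; rewrite edistxx ltW.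
have BK : trace_ball Omega eps x `<=` K by move=> y [cy yx]; split=> //; lra.
have uu := cont_usc cu.
have [z [Kz zmax]] : exists z, K z /\ forall y, K y -> u y <= u z.
  by apply: usc_max => //; [exists x|exact: sub_usc_on KO uu].
have [y [By ymax]] : exists y, trace_ball Omega eps x y /\
    forall w, trace_ball Omega eps x w -> u w <= u y.
  apply: usc_max; [exact: compact_trace_ball|by exists x|].
  by apply: sub_usc_on uu; apply: subset_trans KO.
have [k [Kk kmax]] : exists k, K k /\ forall y, K y -> h y <= h k.
  by apply: usc_max => //; [exists x|exact: sub_usc_on KO uh].
have hC w : K w -> h w <= supB Omega (2 * eps) h x.
  by move=> Kw; exact: le_supB Kw kmax.
have uxE : supB Omega eps u x = u y.
  by apply/eqP; rewrite eq_le (supB_le cx (ltW e0) ymax) (le_supB By ymax).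
have uz w v : trace_ball Omega eps x w -> trace_ball Omega eps w v -> u v <= u z.
  move=> xw wv; apply: zmax; have := trace_ball_trans xw wv.
  by rewrite /K mulr_natl mulr2n.
(* [x] belongs to the ball around each [w] of its own ball. *)
have inf_ge : u x <= infB Omega eps (supB Omega eps u) x.
  apply: lb_le_inf => [|_ [w [cw wx] <-]]; first by exists (supB Omega eps u x), x.
  apply: (@le_supB _ _ _ _ u w x (u z)) => [|v]; first by split=> //; rewrite edistC.
  by apply: uz; split.
(* A maximizer [z] on the large ball is reached in two steps of length eps through a midpoint. If
   [GN] is empty, the whole boundary is [GD], farther than 2 eps from [x]. *)
have sup_ge : u z <= supB Omega eps (supB Omega eps u) x.
  have [|w [xw wz]] := @midpoint_trace_ball R n Omega x z eps _ cx Kz.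
    have [GN0|GN0] := pselect (GN !=set0); [by left; exact: cvx|right=> w bw].
    have /(@setdist_le R n GD x w) : GD w by split=> // Aw; apply: GN0; exists w.
    by lra.
  apply: (@le_trans _ _ (supB Omega eps u w)).
    by apply: le_supB wz _ => v; exact: uz.
  apply: (le_supB (M := u z) xw) => v xv; apply: supB_le; [by case: xv|exact: ltW|].
  by move=> v'; exact: uz.
have main := profile_comparison n0 oO nuO cvx sub e0 cu KO cx By zmax hC.
rewrite /Sminus /Splus uxE a_plusE a_minusE.
have T0 := theta_gt0 beta e0; have E0 := expo_gt0 beta eps.
set T := theta _ _ in T0 main *; set E := expo _ _ in E0 main *.
set I := infB _ _ _ _ in inf_ge *; set S := supB _ _ (supB _ _ _) _ in sup_ge *.
have -> : E / T * ((u y - I) / eps) - T^-1 * ((S - u y) / eps) =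
    (E * (u y - I) - (S - u y)) / (eps * T).
  by field; rewrite !gt_eqF.
rewrite ler_pdivrMr ?mulr_gt0 //; apply: le_trans main.
have : 0 <= E * (I - u x) by rewrite mulr_ge0 ?subr_ge0 // ltW.
lra.
Qed.
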